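(* Let $h>0$, $\psi\in[0,\pi]$, and let $\theta=\frac{\pi}{2}+\frac{\psi}{2}$ or $\theta=\frac{\pi}{2}-\frac{\psi}{2}$. Let $n\geq2$ be an integer, with $n\geq3$ if $\psi=\pi$. Then $$\mathrm{mesh}\,\Delta_{\theta,h}(x^n)=\frac{h\,\sin\frac{\pi}{n}}{\cos\frac{\pi-\psi}{2n}\cdot\cos\frac{\pi+\psi}{2n}}\quad\text{if } n\text{ is even},$$ $$\mathrm{mesh}\,\Delta_{\theta,h}(x^n)=\frac{h\,\sin\frac{\pi}{n}}{\cos\frac{\psi}{2n}\cdot\cos\frac{2\pi-\psi}{2n}}\quad\text{if } n\text{ is odd}.$$
   Context: The operator is $$\Delta_{\theta,h}(p)(x)=\frac{e^{i\theta}p(x+ih)-e^{-i\theta}p(x-ih)}{2i}.$$ The polynomials $\Delta_{\theta,h}(x^n)$ are real with only real roots. For a real polynomial with only real roots $x_1\leq\dots\leq x_N$, $N\geq2$, its mesh is $\min_{1\leq j\leq N-1}(x_{j+1}-x_j)$. *)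

(* Defs.v *)
From HB Require Import structures.
From mathcomp Require Import all_boot all_order all_algebra.
From mathcomp Require Import polyrcf complex.
From mathcomp Require Import reals trigo.

Set Implicit Arguments.
Unset Strict Implicit.
Unset Printing Implicit Defensive.

Import Order.TTheory GRing.Theory Num.Theory.

Local Open Scope ring_scope.
Local Open Scope complex_scope.

Definition expi (R : realType) (t : R) : R[i] := cos t +i* sin t.

Definition Delta (R : realType) (theta h : R) (p : {poly R[i]}) : {poly R[i]} :=
  (2%:R * 'i%C)^-1 *:
    (expi theta *: (p \Po ('X + ('i%C * h%:C)%:P))
     - expi (- theta) *: (p \Po ('X - ('i%C * h%:C)%:P))).

(* [root _ z] holds for every z when p = 0, so the zero polynomial is not
   real-rooted, while nonzero constants are. *)
Definition real_rooted (R : realType) (p : {poly R}) : Prop :=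
  forall z : R[i], root (map_poly (real_complex R) p) z -> complex.Im z = 0.

(* The real roots of p, repeated according to multiplicity; the list is
   nondecreasing because [rootsR p] lists the distinct roots increasingly. *)
Definition root_seq (R : realType) (p : {poly R}) : seq R :=
  flatten [seq nseq (mup x p) x | x <- rootsR p].

(* Meaningful when [root_seq p] has at least two items: the first gap, which
   is the neutral value of the iterated minimum, then belongs to the range. *)
Definition mesh (R : realType) (p : {poly R}) : R :=
  let x := root_seq p in
  \big[Num.min/x`_1 - x`_0]_(0 <= j < (size x).-1) (x`_j.+1 - x`_j).

(* Main.v *)
(** Write [Q] for the imaginary part of [e^(i theta) (x + i h)^n] for real [x]:
    it is a real polynomial, and [Delta theta h 'X^n] is [Q].  At
    [x = h cot phi], where [x + i h = h e^(i phi) / sin phi], it takes the value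
    [h^n sin (theta + n phi) / sin^n phi], so [Q] vanishes at
    [x_j = - h cot beta_j] with [beta_j = (tau + j pi) / n], [tau] being
    congruent to [theta] mod [pi] and [0 < tau <= pi].  There are as many of
    these as the degree of [Q] allows, hence they are all the roots.  The gap
    [x_(j+1) - x_j] is [h sin (pi / n) / (sin beta_j sin beta_(j+1))], and
    [2 sin beta_j sin beta_(j+1)], which equals
    [cos (pi / n) + cos (beta_j + beta_(j+1) - pi)], is largest when
    [beta_j + beta_(j+1)] is closest to [pi].  With [tau = (pi + s) / 2] and
    [s = psi] or [s = - psi], that distance is [|t pi + s| / n] with
    [t = 2 (j + 1) - n], whose minimum is [psi / n] for even [n] and
    [(pi - psi) / n] for odd [n]. *)

Require Import Defs.
From HB Require Import structures.
From mathcomp Require Import all_boot all_order all_algebra.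
From mathcomp Require Import polyrcf complex.
From mathcomp Require Import reals trigo.
From mathcomp Require Import ring lra zify.

Set Implicit Arguments.
Unset Strict Implicit.
Unset Printing Implicit Defensive.

Import Order.TTheory GRing.Theory Num.Theory.

Local Open Scope ring_scope.

(** * Recognizing a complete list of simple real roots *)

(** The distinct roots in [s] are as many as the size of [p] permits, so [p] is a constant times the
    product of the ['X - z%:P]; hence all roots are simple and real. *)
Lemma root_seq_sorted_roots (R : realType) (p : {poly R}) (s : seq R) :
  p != 0 -> (size p <= (size s).+1)%N -> sorted <%R s -> all (root p) s ->
  root_seq p = s /\ real_rooted p.
Proof.
move=> p0 szp ss rs.
have us : uniq s by rewrite (sorted_uniq lt_trans ltxx).
have szE : size p = (size s).+1.
  by apply/eqP; rewrite eqn_leq szp max_poly_roots.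
have pE : p = lead_coef p *: \prod_(z <- s) ('X - z%:P).
  by apply: all_roots_prod_XsubC; rewrite // uniq_rootsE.
have lc0 : lead_coef p != 0 by rewrite lead_coef_eq0.
have rootE x : root p x = (x \in s).
  by rewrite [in LHS]pE rootZ // root_prod_XsubC.
have rE : rootsR p = s.
  apply: (irr_sorted_eq lt_trans ltxx) => //; first exact: sorted_roots.
  by move=> x; rewrite -roots_on_rootsR // in_itv /= rootE.
split.
  rewrite /root_seq rE -[RHS]flatten_seq1.
  congr flatten; apply/eq_in_map => x xs /=.
  rewrite [p]pE -mul_polyC mupMr ?rootC // mu_prod_XsubC.
  by rewrite count_uniq_mem // xs.
move=> z; rewrite pE map_polyZ rootZ ?fmorph_eq0 // rmorph_prod /=.
under eq_bigr do rewrite map_polyXsubC.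
rewrite -(big_map (real_complex R) xpredT (fun y => 'X - y%:P)).
by rewrite root_prod_XsubC => /mapP[x _ ->].
Qed.

(** * Recursion, size and values of the real and imaginary parts *)

Section RealImag.
Variables (R : realType) (h theta : R).

(* The real and imaginary parts of [e^(i theta) (x + i h)^n]. *)
Definition reim n : {poly R} * {poly R} :=
  iter n (fun u => ('X * u.1 - h%:P * u.2, 'X * u.2 + h%:P * u.1))
    ((cos theta)%:P, (sin theta)%:P).

Local Notation toC := (map_poly (real_complex R)).

(** With [P] and [Q] the two parts, one step of the recursion multiplies [P + i Q] by [X + i h] and
    [P - i Q] by [X - i h]. *)
Lemma reimE n :
  toC (reim n).1 + 'i%C%:P * toC (reim n).2 =
    expi theta *: ('X + ('i%C * h%:C%C)%:P) ^+ n /\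
  toC (reim n).1 - 'i%C%:P * toC (reim n).2 =
    expi (- theta) *: ('X - ('i%C * h%:C%C)%:P) ^+ n.
Proof.
have iE : 'i%C%:P * 'i%C%:P = -1 :> {poly R[i]}.
  by rewrite -polyCM -expr2 sqr_i polyCN.
elim: n => [|n [IH1 IH2]].
  rewrite !expr0 /= !map_polyC /= !alg_polyC -!polyCM -polyCD -polyCB.
  by split; congr _%:P; apply/eqP; rewrite eq_complex /= ?cosN ?sinN; simpc.
rewrite !exprSr !scalerAl -IH1 -IH2 /= !(rmorphD, rmorphN, rmorphM) /=.
rewrite !map_polyX !map_polyC /=.
set P := toC _; set Q := toC _; set I := 'i%C%:P in iE *; set H := _%:P.
split; ring: iE.
Qed.

Lemma Delta_reim n :
  Delta theta h 'X^n = toC (reim n).2.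
Proof.
rewrite /Delta !comp_Xn_poly; have [<- <-] := reimE n.
set P := toC _; set Q := toC _.
have -> : P + 'i%C%:P * Q - (P - 'i%C%:P * Q) = (2%:R * 'i%C) *: Q.
  by rewrite -mul_polyC polyCM polyC_natr; ring.
rewrite scalerA mulVf ?scale1r // mulf_neq0 ?pnatr_eq0 //.
by rewrite -sqrf_eq0 sqr_i oppr_eq0 oner_eq0.
Qed.

(** The coefficient of [x^n] in the imaginary part is [sin theta], so the bound drops by one when
    that sine vanishes. *)
Lemma size_reim n :
  (size (reim n).1 <= n.+1)%N /\ (size (reim n).2 <= n + (sin theta != 0%R))%N.
Proof.
elim: n => [|n [IH1 IH2]]; first by rewrite /= !size_polyC; case: (_ != 0).
have szX (p : {poly R}) : (size ('X * p)%R <= (size p).+1)%N.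
  by rewrite (leq_trans (size_polyMleq _ _)) // size_polyX.
have szC (p : {poly R}) : (size (h%:P * p)%R <= size p)%N.
  by rewrite mul_polyC size_scale_leq.
split=> /=.
  rewrite (leq_trans (size_polyD _ _)) // size_polyN geq_max.
  rewrite (leq_trans (szX _)) // (leq_trans (szC _)) // (leq_trans IH2) //.
  by rewrite -addn2 leq_add2l; case: (_ != 0).
rewrite (leq_trans (size_polyD _ _)) // geq_max.
rewrite (leq_trans (szX _)) // (leq_trans (szC _)) // (leq_trans IH1) //.
by rewrite addSn ltnS leq_addr.
Qed.

(** The hypothesis is [x = h cot phi] cleared of its denominator; after scaling by [sin phi ^+ n],
    the recursion becomes the addition formulas for the angle [phi]. *)
Lemma horner_reim n phi x : x * sin phi = h * cos phi ->
  (reim n).1.[x] * sin phi ^+ n = h ^+ n * cos (theta + phi *+ n) /\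
  (reim n).2.[x] * sin phi ^+ n = h ^+ n * sin (theta + phi *+ n).
Proof.
move=> xE; elim: n => [|n [IH1 IH2]].
  by rewrite /= !hornerC !mulr0n addr0 !expr0 !mulr1 !mul1r.
rewrite /= !hornerE !mulrSr !addrA !exprSr.
rewrite (cosD (theta + _)) (sinD (theta + _)).
set P := _.1.[x] in IH1 *; set Q := _.2.[x] in IH2 *.
split.
  transitivity (x * sin phi * (P * sin phi ^+ n) -
                h * sin phi * (Q * sin phi ^+ n)).
    by ring.
  by rewrite IH1 IH2 xE; ring.
transitivity (x * sin phi * (Q * sin phi ^+ n) +
              h * sin phi * (P * sin phi ^+ n)).
  by ring.
by rewrite IH1 IH2 xE; ring.
Qed.

End RealImag.

Lemma reim2_neq0 (R : realType) (h theta : R) n :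
  0 < h -> (2 <= n)%N -> 0 <= theta -> theta <= pi -> (reim h theta n).2 != 0.
Proof.
move=> h_gt0 n_ge2 theta_ge0 theta_le; have pi0 := pi_gt0 R.
have n2 : (2 : R) <= n%:R by rewrite ler_nat.
(* Chosen so that [theta + n phi = 3 pi / 2], where the sine is -1; the numerator lies between
   [pi / 2] and [3 pi / 2], so [n >= 2] puts [phi] in [(0, pi)]. *)
pose phi : R := (pi * 3 / 2 - theta) / n%:R.
have phi_gt0 : 0 < sin phi.
  rewrite sin_gt0_pi // divr_gt0 //=; [|lra|lra].
  by rewrite ltr_pdivrMr; [nra|lra].
apply/eqP => p0.
have xE : h * cos phi / sin phi * sin phi = h * cos phi.
  by rewrite divfK // lt0r_neq0.
have [_] := horner_reim theta n xE.
rewrite p0 horner0 mul0r -mulr_natr divfK; last by rewrite lt0r_neq0; lra.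
have -> : theta + (pi * 3 / 2 - theta) = pi / 2 + pi by field.
rewrite sinDpi sin_pihalf mulrN1 => /esym/eqP.
by rewrite oppr_eq0 expf_eq0 (gt_eqF h_gt0) andbF.
Qed.

(** * Least gaps and comparison of cosines *)

Lemma mesh_eq (R : realType) (p : {poly R}) (x : nat -> R) (N k : nat) :
  root_seq p = mkseq x N -> (k.+1 < N)%N ->
  (forall j, (j.+1 < N)%N -> x k.+1 - x k <= x j.+1 - x j) ->
  mesh p = x k.+1 - x k.
Proof.
move=> pE kN kmin; rewrite /mesh pE size_mkseq.
have gapE j : (j.+1 < N)%N ->
    (mkseq x N)`_j.+1 - (mkseq x N)`_j = x j.+1 - x j.
  by move=> jN; rewrite !nth_mkseq // ltnW.
rewrite big_nat; apply/eqP; rewrite eq_le; apply/andP; split.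
  rewrite -big_nat -[leRHS]gapE // ge_bigmin_seq //.
  by rewrite mem_index_iota; lia.
(* The neutral value of the minimum is the gap of index 0, so [kmin] bounds it too. *)
apply: le_bigmin => [|j /andP[_ jN]]; rewrite gapE ?kmin //; lia.
Qed.

(** Writing [- cos (a + b)] as [cos (a + b - pi)] exposes the distance from [a + b] to [pi], all
    that varies once [b - a] is fixed. *)
Lemma sin_mul_sin (R : realType) (a b : R) :
  sin a * sin b = (cos (b - a) + cos (a + b - pi)) / 2.
Proof. by rewrite (cosB (a + b)) cospi sinpi cosB cosD; field. Qed.

Lemma cos_mul_cos (R : realType) (a b : R) :
  cos a * cos b = (cos (a + b) + cos (a - b)) / 2.
Proof. by rewrite cosB cosD; field. Qed.

Lemma ler_cos_norm (R : realType) (u v : R) :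
  `|u| <= `|v| -> `|v| <= pi -> cos v <= cos u.
Proof.
move=> uv vpi; rewrite -(cos_norm u) -(cos_norm v) leNgt ltr_cos ?in_itv /=.
- by rewrite -leNgt.
- by rewrite normr_ge0.
- by rewrite normr_ge0 (le_trans uv).
Qed.

(** * Explicit roots and their gaps *)

Section ReimRoots.
Variables (R : realType) (h theta tau : R) (n N : nat).
Hypotheses (h_gt0 : 0 < h) (n_ge2 : (2 <= n)%N).
Hypotheses (theta_ge0 : 0 <= theta) (theta_le : theta <= pi).
Hypotheses (tau_gt0 : 0 < tau) (sin_tau : sin (theta - tau) = 0).
(** [tau_lt] keeps the angles [beta j] below [pi]; [N_ge] ensures that [N] roots exhaust the size
    bound. *)
Hypothesis tau_lt : forall j, (j < N)%N -> tau + j%:R * pi < n%:R * pi.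
Hypothesis N_ge : (n + (sin theta != 0%R) <= N.+1)%N.

Let p := (reim h theta n).2.
Let beta j : R := (tau + j%:R * pi) / n%:R.
Let x j : R := - h * cos (beta j) / sin (beta j).

Let n_gt0 : (0 : R) < n%:R. Proof. by rewrite ltr0n; lia. Qed.

Let pi0 : (0 : R) < pi. Proof. exact: pi_gt0. Qed.

Let beta_gt0 j : 0 < beta j.
Proof. by rewrite divr_gt0 // ltr_wpDr // mulr_ge0 // ltW. Qed.

Let beta_lt j : (j < N)%N -> beta j < pi.
Proof. by move=> jN; rewrite ltr_pdivrMr // [ltRHS]mulrC tau_lt. Qed.

Let betaS j : beta j.+1 - beta j = pi / n%:R.
Proof. by rewrite /beta -natr1; field; rewrite lt0r_neq0. Qed.

Let sin_beta j : (j < N)%N -> 0 < sin (beta j).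
Proof. by move=> jN; rewrite sin_gt0_pi // beta_gt0 beta_lt. Qed.

Let gap j : (j.+1 < N)%N ->
  x j.+1 - x j = h * sin (pi / n%:R) / (sin (beta j) * sin (beta j.+1)).
Proof.
move=> jN; have s1 := lt0r_neq0 (sin_beta jN).
have s0 := lt0r_neq0 (sin_beta (ltnW jN)).
by rewrite -(betaS j) sinB /x; field; rewrite s0 s1.
Qed.

Let sin_pin : 0 < sin (pi / n%:R : R).
Proof.
rewrite sin_gt0_pi // divr_gt0 //= ltr_pdivrMr // ltr_pMr // ltr1n.
by lia.
Qed.

Lemma root_seq_reim : root_seq p = mkseq x N /\ real_rooted p.
Proof.
apply: root_seq_sorted_roots.
- exact: reim2_neq0.
- by rewrite size_mkseq (leq_trans (size_reim h theta n).2).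
- apply/(sortedP 0) => j; rewrite size_mkseq => jN.
  rewrite !nth_mkseq ?(ltnW jN) // -subr_gt0 gap // divr_gt0 ?mulr_gt0 //.
    by rewrite sin_beta // ltnW.
  by rewrite sin_beta.
- apply/allP => y /mapP[j]; rewrite mem_iota => /= jN -> {y}.
  have s0 := sin_beta jN.
  (* As [x j = h cot (- beta j)], the value there is governed by [sin (theta - tau - j pi)], which
     is zero. *)
  have xE : x j * sin (- beta j) = h * cos (- beta j).
    by rewrite sinN cosN /x; field; rewrite lt0r_neq0.
  have [_] := horner_reim theta n xE.
  rewrite -/p mulNrn -mulr_natr divfK ?lt0r_neq0 // opprD addrA sinB sin_tau.
  have -> : sin (j%:R * pi : R) = 0.
    by rewrite mulr_natl -[_ *+ j]add0r (alternatingn (@sinDpi R)) sin0 mulr0.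
  rewrite mul0r mulr0 subrr mulr0 => /eqP.
  by rewrite mulf_eq0 expf_eq0 sinN oppr_eq0 (gt_eqF s0) andbF orbF.
Qed.

(** The angles [a] and [b] are those of the closed formula: their sum is the spacing of the [beta j]
    and their difference the least distance to [pi], so the two product-to-sum formulas agree at
    [k]. *)
Lemma mesh_reim k a b : (k.+1 < N)%N -> a + b = pi / n%:R ->
  `|beta k + beta k.+1 - pi| = `|a - b| ->
  (forall j, (j.+1 < N)%N -> `|a - b| <= `|beta j + beta j.+1 - pi|) ->
  mesh p = h * sin (pi / n%:R) / (cos a * cos b).
Proof.
move=> kN abE kE kmin.
have sinE : sin (beta k) * sin (beta k.+1) = cos a * cos b.
  rewrite sin_mul_sin cos_mul_cos betaS abE.
  by rewrite -[cos (_ - pi)]cos_norm -[cos (a - b)]cos_norm kE.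
rewrite -sinE (mesh_eq root_seq_reim.1 kN) ?gap // => j jN.
have sin_beta2 i : (i.+1 < N)%N -> 0 < sin (beta i) * sin (beta i.+1).
  by move=> iN; rewrite mulr_gt0 // sin_beta // ltnW.
rewrite !gap // ler_pM2l; last by rewrite mulr_gt0.
rewrite lef_pV2 ?posrE ?sin_beta2 //.
rewrite !sin_mul_sin !betaS ler_pM2r ?invr_gt0 ?ltr0n // lerD2l.
rewrite ler_cos_norm //.
  by rewrite kE kmin.
(* Both angles lie in [(0, pi)], so their sum is within [pi] of [pi]. *)
have := beta_gt0 j; have := beta_gt0 j.+1; have := beta_lt jN.
have := beta_lt (ltnW jN); rewrite ler_norml; lra.
Qed.

End ReimRoots.

(** * Optimal pair of consecutive roots, by parity of [n] *)

(** A nonzero even multiple of [pi] moves [s] to absolute value at least [2 pi - |s| >= |s|]. *)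
Lemma le_norm_even_shift (R : realType) (s : R) (j q : nat) :
  `|s| <= pi -> `|s| <= `|(j%:R - q%:R) *+ 2 * pi + s|.
Proof.
move=> s_le; have pi0 := pi_gt0 R.
have := ler_norm s; have := ler_norm (- s); rewrite normrN => s1 s2.
have [jq|qj|<-] := ltngtP j q; last by rewrite subrr mul0rn mul0r add0r.
  have : pi <= (q%:R - j%:R) * pi :> R.
    by rewrite ler_peMl ?(ltW pi0) // lerBrDr [_ + _]addrC natr1 ler_nat.
  by move=> T_ge; rewrite ler_normr; apply/orP; right; lra.
have : pi <= (j%:R - q%:R) * pi :> R.
  by rewrite ler_peMl ?(ltW pi0) // lerBrDr [_ + _]addrC natr1 ler_nat.
by move=> T_ge; rewrite ler_normr; apply/orP; left; lra.
Qed.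

(** An odd multiple of [pi] has absolute value at least [pi]; the triangle inequality does the
    rest. *)
Lemma le_norm_odd_shift (R : realType) (s : R) (j q : nat) :
  pi - `|s| <= `|((j%:R - q%:R) *+ 2 - 1) * pi + s|.
Proof.
have pi0 := pi_gt0 R.
have := ler_norm s; have := ler_norm (- s); rewrite normrN => s1 s2.
have [qj|jq] := ltnP q j.
  have : pi <= (j%:R - q%:R) * pi :> R.
    by rewrite ler_peMl ?(ltW pi0) // lerBrDr [_ + _]addrC natr1 ler_nat.
  by move=> T_ge; rewrite ler_normr; apply/orP; left; lra.
have : 0 <= (q%:R - j%:R) * pi :> R.
  by rewrite mulr_ge0 ?(ltW pi0) // subr_ge0 ler_nat.
by move=> T_ge; rewrite ler_normr; apply/orP; right; lra.
Qed.

(* [s = - pi] can be left out: when [theta = 0] the roots are those for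
   [theta = pi], which is covered by [s = pi]. *)
Lemma real_rooted_mesh_reim (R : realType) (h psi theta s : R) (n N : nat)
    (p := (reim h theta n).2) :
  0 < h -> (2 <= n)%N -> 0 <= theta -> theta <= pi ->
  0 <= psi -> s = psi \/ s = - psi -> - pi < s -> s <= pi ->
  sin (theta - (pi + s) / 2) = 0 ->
  s < pi /\ N = n \/ [/\ s = pi, sin theta = 0, N = n.-1 & (3 <= n)%N] ->
  [/\ real_rooted p, (2 <= size (root_seq p))%N,
      ~~ odd n ->
        mesh p = h * sin (pi / n%:R) /
          (cos ((pi - psi) / (2%:R * n%:R)) *
           cos ((pi + psi) / (2%:R * n%:R)))
    & odd n ->
        mesh p = h * sin (pi / n%:R) /
          (cos (psi / (2%:R * n%:R)) *
           cos ((2%:R * pi - psi) / (2%:R * n%:R)))].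
Proof.
move=> h_gt0 n_ge2 th0 thpi psi0 s_psi s_gt s_le sin0 NE.
have [N_ge2 N_gen] : (2 <= N)%N /\ (n <= N.+1)%N.
  by clear -n_ge2 NE; case: NE => [[_ ->]|[_ _ -> n3]]; lia.
have pi0 := pi_gt0 R.
have n_gt0 : (0 : R) < n%:R by rewrite ltr0n; apply: leq_trans n_ge2.
have n0 : n%:R != 0 :> R by rewrite lt0r_neq0.
have normV : `|n%:R^-1| = n%:R^-1 :> R by rewrite gtr0_norm ?invr_gt0.
have normsE : `|s| = psi by case: s_psi => ->; rewrite ?normrN ger0_norm.
have psi_le : psi <= pi by rewrite -normsE ler_norml s_le ltW.
have tau_gt0 : 0 < (pi + s) / 2 by lra.
(* For [s < pi] the index [n - 1] still gives an angle below [pi]; for [s = pi], [tau] is [pi] and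
   the last admissible index is [n - 2]. *)
have tau_lt j : (j < N)%N -> (pi + s) / 2 + j%:R * pi < n%:R * pi.
  case: NE => [[s_lt ->] jn|[_ _ -> n3] jn].
    have : (j%:R + 1) * pi <= n%:R * pi :> R.
      by rewrite ler_pM2r // natr1 ler_nat.
    by lra.
  have : (j%:R + 2) * pi <= n%:R * pi :> R.
    by rewrite ler_pM2r // -natrD ler_nat addn2; clear -jn n3; lia.
  by lra.
have N_ge : (n + (sin theta != 0%R) <= N.+1)%N.
  case: NE => [[_ ->]|[_ -> _ _]]; last by rewrite eqxx addn0.
  by case: (_ != 0); rewrite ?addn1 ?addn0.
have [rE rr] := root_seq_reim h_gt0 n_ge2 th0 thpi tau_gt0 sin0 tau_lt N_ge.
have mE := mesh_reim h_gt0 n_ge2 th0 thpi tau_gt0 sin0 tau_lt N_ge.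
split=> //.
- by rewrite rE size_mkseq.
- move=> n_even; have nE : n = n./2.*2 by rewrite even_halfK.
  set q := n./2 in nE.
  have nRE : n%:R = q%:R * 2 :> R by rewrite nE -muln2 natrM.
  have shiftE j : ((pi + s) / 2 + j%:R * pi) / n%:R +
      ((pi + s) / 2 + j.+1%:R * pi) / n%:R - pi =
      ((j.+1%:R - q%:R) *+ 2 * pi + s) / n%:R.
    apply: (mulIf n0); rewrite mulrDl mulNr mulrDl !divfK // nRE -natr1.
    by field.
  have abE : `|(pi - psi) / (2 * n%:R) - (pi + psi) / (2 * n%:R)| = `|s| / n%:R.
    rewrite (_ : _ - _ = - psi / n%:R); last by field.
    by rewrite normrM normV normrN normsE ger0_norm.
  (* At [j = q - 1] the multiple of [pi] in [shiftE] vanishes, leaving [|s| / n]. *)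
  apply: (mE q.-1).
  + by clear -N_ge2 N_gen nE; lia.
  + by field.
  + have q0 : (0 < q)%N by clear -n_ge2 nE; lia.
    by rewrite abE shiftE prednK // subrr mul0rn mul0r add0r normrM normV.
  + move=> j _; rewrite abE shiftE normrM normV.
    by rewrite ler_pM2r ?invr_gt0 // le_norm_even_shift // normsE.
move=> n_odd; have nE : n = n./2.*2.+1 by rewrite -[LHS]odd_double_half n_odd.
set q := n./2 in nE.
have nRE : n%:R = q%:R * 2 + 1 :> R by rewrite nE -muln2 -natr1 natrM.
have shiftE j : ((pi + s) / 2 + j%:R * pi) / n%:R +
    ((pi + s) / 2 + j.+1%:R * pi) / n%:R - pi =
    (((j.+1%:R - q%:R) *+ 2 - 1) * pi + s) / n%:R.
  by apply: (mulIf n0); rewrite mulrDl mulNr mulrDl !divfK // nRE -natr1; field.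
have abE : `|psi / (2 * n%:R) - (2 * pi - psi) / (2 * n%:R)| =
    (pi - `|s|) / n%:R.
  rewrite (_ : _ - _ = (psi - pi) / n%:R); last by field.
  by rewrite normrM normV normsE distrC ger0_norm ?subr_ge0.
have kmin j : (pi - `|s|) / n%:R <=
    `|(((j.+1%:R - q%:R) *+ 2 - 1) * pi + s) / n%:R|.
  rewrite normrM normV.
  by rewrite ler_pM2r ?invr_gt0 // le_norm_odd_shift.
(* The multiples nearest 0 are [- pi] at [j = q - 1] and [pi] at [j = q]; the one opposite in sign
   to [s] attains the bound. *)
case: (s_psi) => sE.
  apply: (mE q.-1).
  + by clear -N_ge2 N_gen nE; lia.
  + by field.
  + have q0 : (0 < q)%N by clear -n_ge2 nE; lia.
    rewrite abE shiftE prednK // subrr mul0rn add0r mulN1r normrM normV normsE.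
    by rewrite addrC sE distrC ger0_norm ?subr_ge0.
  + by move=> j _; rewrite abE shiftE.
apply: (mE q).
(* Having [n - 1] roots would require [s = pi], impossible for [s = - psi <= 0]. *)
+ case: NE => [[_ ->]|[s_pi _ _ _]]; first by clear -n_ge2 nE; lia.
  by clear -pi0 psi0 sE s_pi; lra.
+ by field.
+ rewrite abE shiftE -natr1 (addrC q%:R) addrK mulr2n addrK mul1r normrM normV.
  by rewrite normsE sE ger0_norm ?subr_ge0.
+ by move=> j _; rewrite abE shiftE.
Qed.

Theorem proposition4p2 (R : realType) (h psi theta : R) (n : nat)
    (h_gt0 : 0 < h) (psi_ge0 : 0 <= psi) (psi_lepi : psi <= pi)
    (theta_def : theta = pi / 2%:R + psi / 2%:R \/
                 theta = pi / 2%:R - psi / 2%:R)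
    (n_ge2 : (2 <= n)%N) (n_ge3 : psi = pi -> (3 <= n)%N) :
  exists p : {poly R},
    [/\ map_poly (real_complex R) p = Delta theta h ('X^n),
        real_rooted p,
        (2 <= size (root_seq p))%N,
        ~~ odd n ->
          mesh p = h * sin (pi / n%:R) /
            (cos ((pi - psi) / (2%:R * n%:R)) *
             cos ((pi + psi) / (2%:R * n%:R)))
      & odd n ->
          mesh p = h * sin (pi / n%:R) /
            (cos (psi / (2%:R * n%:R)) *
             cos ((2%:R * pi - psi) / (2%:R * n%:R)))].
Proof.
exists (reim h theta n).2; rewrite -Delta_reim.
have pi0 := pi_gt0 R.
have th0 : 0 <= theta by case: theta_def => ->; lra.
have thpi : theta <= pi by case: theta_def => ->; lra.
suff [s [N [s_psi s_gt s_le sin0 NE]]] : exists s N,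
    [/\ s = psi \/ s = - psi, - pi < s, s <= pi,
        sin (theta - (pi + s) / 2) = 0 &
        s < pi /\ N = n \/ [/\ s = pi, sin theta = 0, N = n.-1 & (3 <= n)%N]].
  by have [] := real_rooted_mesh_reim h_gt0 n_ge2 th0 thpi psi_ge0
    s_psi s_gt s_le sin0 NE.
have [psi_lt|psi_pi] : psi < pi \/ psi = pi.
  by move: psi_lepi; rewrite le_eqVlt => /orP[/eqP|]; [right|left].
  (* The sign of [s] makes [(pi + s) / 2] equal to [theta]. *)
  case: theta_def => ->; [exists psi|exists (- psi)]; exists n.
    rewrite (_ : _ - _ = 0) ?sin0; last by field.
    by split; [left|lra|lra| |left].
  rewrite (_ : _ - _ = 0) ?sin0; last by field.
  by split; [right|lra|lra| |left; split=> //; lra].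
(* Now [theta] is [pi] or 0, congruent mod [pi] to [tau = pi] in both cases, and [sin theta = 0]
   lowers the degree. *)
exists pi, n.-1; rewrite psi_pi in theta_def *.
case: theta_def => ->.
  rewrite (_ : pi / 2 + pi / 2 = pi); last by field.
  rewrite (_ : _ - _ = 0) ?sin0 ?sinpi; last by field.
  by split; [left|lra|lra| |right; split=> //; exact: n_ge3].
rewrite subrr sub0r sinN (_ : (pi + pi) / 2 = pi); last by field.
rewrite sinpi sin0 oppr0.
by split; [left|lra|lra| |right; split=> //; exact: n_ge3].
Qed.
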